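(* Let $m\ge 1$ be an integer and let $G$ be a finite simple graph with vertex set $V(G)=\{v_1,\dots,v_n\}$. Let $D_m(G)$ be the $m$-shadow graph of $G$, obtained by taking $m$ copies of $G$ and joining every vertex in each copy to all neighbours of the corresponding vertex in every other copy; let $v_{r,k}$ denote the vertex corresponding to $v_k$ in the $r$-th copy. Then for every $r\in\{1,\dots,m\}$ and every $k\in\{1,\dots,n\}$, \[ \mathcal{E}_{D_m(G)}(v_{r,k})=\mathcal{E}_G(v_k). \]
   Context: Vertex energy: for a finite simple (undirected, loopless) graph $H$ with vertices $w_1,\dots,w_N$ and adjacency matrix $A(H)$, write the spectral decomposition $A(H)=\sum_{i=1}^N \lambda_i u_iu_i^T$, where $\lambda_1,\dots,\lambda_N$ are the eigenvalues of $A(H)$ (with multiplicity) and $u_i=(u_{i1},\dots,u_{iN})^T$ are corresponding orthonormal real eigenvectors. The vertex energy of $w_k$ is $\mathcal{E}_H(w_k)=\sum_{i=1}^N|\lambda_i|\,u_{ik}^2$ (this does not depend on the choice of orthonormal eigenbasis). $m$-shadow graph: for a positive integer $m$, $D_m(G)$ is defined by taking $m$ disjoint copies $G^1,\dots,G^m$ of $G$ with vertex sets $V(G^r)=\{v_{r,1},\dots,v_{r,n}\}$ (each copy keeping its own edges), and, whenever $v_iv_j\in E(G)$, joining $v_{r,i}$ to $v_{s,j}$ for all $r\neq s$. No additional edges are added inside any individual copy. Thus $v_{r,i}$ and $v_{s,j}$ are adjacent in $D_m(G)$ (for any $r,s$, equal or not) if and only if $v_iv_j\in E(G)$. *)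

(* Defs.v *)
From mathcomp Require Import all_boot all_order all_algebra.
From mathcomp Require Import complex.

Set Implicit Arguments.
Unset Strict Implicit.
Unset Printing Implicit Defensive.

Import Order.TTheory GRing.Theory Num.Theory.
Local Open Scope ring_scope.

Record sgraph := SGraph {
  vertex :> finType;
  adj : rel vertex;
  adj_sym : symmetric adj;
  adj_irrefl : irreflexive adj }.

Section Shadow.
Variables (m : nat) (G : sgraph).

(* The pair (r, v) is the copy of v in G^r.  The first disjunct gives the edges
   inside a copy, the second one the edges joining two distinct copies. *)
Definition shadow_adj : rel ('I_m * G)%type := fun x y =>
  ((x.1 == y.1) && adj x.2 y.2) || ((x.1 != y.1) && adj x.2 y.2).

Lemma shadow_adjE x y : shadow_adj x y = adj x.2 y.2.
Proof. by rewrite /shadow_adj; case: (x.1 == y.1); rewrite ?orbF. Qed.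

Lemma shadow_sym : symmetric shadow_adj.
Proof. by move=> x y; rewrite !shadow_adjE adj_sym. Qed.

Lemma shadow_irrefl : irreflexive shadow_adj.
Proof. by move=> x; rewrite shadow_adjE adj_irrefl. Qed.

Definition shadow : sgraph := SGraph shadow_sym shadow_irrefl.

End Shadow.

Section Spectral.
Variable R : rcfType.

(* The columns of du.2 are the u_i: they are orthonormal, and
   A = \sum_i lambda_i u_i u_i^T with lambda_i = du.1 0 i. *)
Definition spectral_decomp n (A : 'M[R]_n) (du : 'rV[R]_n * 'M[R]_n) : bool :=
  (du.2^T *m du.2 == 1%:M) &&
  (A == \sum_i du.1 0 i *: (col i du.2 *m (col i du.2)^T)).

Lemma sum_col_diag n (d : 'rV[R]_n) (U : 'M[R]_n) :
  \sum_i d 0 i *: (col i U *m (col i U)^T) = U *m diag_mx d *m U^T.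
Proof.
apply/matrixP => j k; rewrite summxE mul_mx_diag !mxE.
apply: eq_bigr => i _; rewrite !mxE big_ord1 !mxE.
by rewrite mulrA; congr (_ * _); rewrite mulrC.
Qed.

Lemma spectral_decompP n (A : 'M[R]_n) d U :
  reflect (U^T *m U = 1%:M /\ A = U *m diag_mx d *m U^T)
          (spectral_decomp A (d, U)).
Proof.
rewrite /spectral_decomp /= sum_col_diag.
by apply: (iffP andP) => -[/eqP ? /eqP ?]; split=> //; apply/eqP.
Qed.

Lemma symmetric_eigenvalue n (A : 'M[R]_n.+1) :
  A^T = A -> exists a, eigenvalue A a.
Proof.
move=> As; pose f := @real_complex R; pose B := map_mx f A.
have Bh : B \is hermsymmx.
  apply: realsym_hermsym.
    by apply/is_hermitianmxP; rewrite expr0 scale1r map_mx_id // /B -{1}As -map_trmx.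
  by apply/mxOverP => i j; rewrite mxE complex_real.
have /mxOverP/(_ 0 0)/RRe_real := hermitian_spectral_diag_real Bh.
have /orthomx_spectralP := hermitian_normalmx Bh.
have := spectral_unit B.
move: (spectralmx B) (spectral_diag B) => P d PU BE dE.
exists (complex.Re (d 0 0)).
rewrite eigenvalue_root_char -(fmorph_root f) map_char_poly -/B /f /= dE.
rewrite -eigenvalue_root_char; apply/eigenvalueP; exists (row 0 P).
  rewrite [in LHS]BE 2!mulmxA -row_mul mulmxV // -row_mul mul1mx row_diag_mx.
  by rewrite -scalemxAl rowE.
apply/eqP => /(congr1 (mulmx^~ (invmx P))); rewrite -row_mul mulmxV // mul0mx.
by move=> /rowP/(_ 0); rewrite !mxE eqxx => /eqP; rewrite oner_eq0.
Qed.

Lemma dot_ge0 n (v : 'rV[R]_n) : 0 <= (v *m v^T) 0 0.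
Proof. by rewrite mxE sumr_ge0 // => i _; rewrite mxE -expr2 sqr_ge0. Qed.

Lemma dot_eq0 n (v : 'rV[R]_n) : (v *m v^T) 0 0 = 0 -> v = 0.
Proof.
move/eqP; rewrite mxE psumr_eq0 => [|i _]; last by rewrite mxE -expr2 sqr_ge0.
move=> /allP v0; apply/rowP => i; rewrite [RHS]mxE; apply/eqP.
by have := v0 i (mem_index_enum i); rewrite mxE -expr2 sqrf_eq0.
Qed.

Lemma unit_eigenvector n (A : 'M[R]_n.+1) : A^T = A ->
  exists a (v : 'rV[R]_n.+1), v *m A = a *: v /\ v *m v^T = 1%:M.
Proof.
move=> /symmetric_eigenvalue[a /eigenvalueP[v vA v0]].
pose q : R := (v *m v^T) 0 0.
have qE : v *m v^T = q%:M by rewrite [LHS]mx11_scalar.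
have q_gt0 : 0 < q.
  by rewrite lt_neqAle dot_ge0 andbT eq_sym; apply: contraNneq v0 => /dot_eq0->.
exists a, ((Num.sqrt q)^-1 *: v); split.
  by rewrite -scalemxAl vA !scalerA mulrC.
rewrite linearZ /= -scalemxAl -scalemxAr scalerA qE scale_scalar_mx.
rewrite -invfM -expr2 sqr_sqrtr ?ltW // mulVf ?gt_eqF //.
Qed.

(* A Householder reflection. *)
Lemma orthogonal_row0 n (v : 'rV[R]_n.+1) : v *m v^T = 1%:M ->
  exists Q : 'M[R]_n.+1, Q *m Q^T = 1%:M /\ row 0 Q = v.
Proof.
move=> v1; pose e : 'rV[R]_n.+1 := delta_mx 0 0; pose w := v - e.
have [w0|w0] := eqVneq w 0.
  exists 1%:M; rewrite trmx1 mulmx1; split=> //.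
  by rewrite row1; apply/eqP; rewrite eq_sym -subr_eq0 -/e -/w w0.
have ev : e *m v^T = (v 0 0)%:M.
  by rewrite -rowE [LHS]mx11_scalar !mxE.
have ve : v *m e^T = (v 0 0)%:M.
  by rewrite -[LHS]trmxK trmx_mul trmxK ev tr_scalar_mx.
have ee : e *m e^T = 1%:M.
  by rewrite /e trmx_delta mul_delta_mx [LHS]mx11_scalar mxE !eqxx.
pose c : R := 1 - v 0 0.
have wE : w *m w^T = (c *+ 2)%:M.
  rewrite /w linearB /= mulmxBl !mulmxBr v1 ev ve ee -!raddfB /=.
  by congr (_%:M); rewrite /c mulr2n opprB.
have ew : e *m w^T = (- c)%:M.
  by rewrite /w linearB /= mulmxBr ev ee -raddfB /= /c opprB.
have c0 : c != 0.
  apply: contraNneq w0 => c0; apply/eqP/dot_eq0.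
  by rewrite wE c0 mul0rn !mxE mul0rn.
pose Q := 1%:M - c^-1 *: (w^T *m w).
have QT : Q^T = Q by rewrite /Q linearB linearZ /= trmx1 trmx_mul trmxK.
exists Q; split.
  have PP : w^T *m w *m (w^T *m w) = c *+ 2 *: (w^T *m w).
    by rewrite mulmxA -(mulmxA w^T) wE mul_mx_scalar -scalemxAl.
  rewrite QT /Q; move: (w^T *m w) PP => P PP.
  rewrite mulmxBl !mulmxBr !mul1mx mulmx1.
  have -> : c^-1 *: P *m (c^-1 *: P) = c^-1 *: P + c^-1 *: P.
    rewrite -scalemxAl -scalemxAr PP !scalerA -scalerDl -mulr2n.
    by rewrite -mulrA mulrnAr mulVf // mulr_natr.
  by rewrite opprB addrK subrK.
rewrite rowE -/e /Q mulmxBr mulmx1 -scalemxAr mulmxA ew mul_scalar_mx scalerA.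
by rewrite mulrN mulVf // scaleN1r opprK /w addrC subrK.
Qed.

Theorem symmetric_spectral n (A : 'M[R]_n) :
  A^T = A -> exists du, spectral_decomp A du.
Proof.
suff: A^T = A ->
    exists d (V : 'M_n), V *m V^T = 1%:M /\ A = V^T *m diag_mx d *m V.
  move=> /[swap] As /(_ As)[d [V [VV AE]]]; exists (d, V^T).
  by apply/spectral_decompP; split; rewrite trmxK.
elim: n A => [|n IHn] A As.
  by exists 0, 1%:M; split; apply/matrixP => -[].
have [a [v [vA /orthogonal_row0[Q [QQ Qv]]]]] := unit_eigenvector As.
have QQ' : Q^T *m Q = 1%:M by apply: mulmx1C.
pose C : 'M_(1 + n) := Q *m A *m Q^T.
have Cs : C^T = C by rewrite /C !trmx_mul trmxK As mulmxA.
have C0 : row 0 C = a *: delta_mx 0 0.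
  by rewrite /C !row_mul Qv vA -Qv -scalemxAl -row_mul QQ row1.
have AE : A = Q^T *m C *m Q.
  by rewrite /C !mulmxA QQ' mul1mx -mulmxA QQ' mulmx1.
move: C Cs C0 AE => C Cs C0 AE.
have C0j j : C 0 j = a *+ (j == 0).
  by have /rowP/(_ j) := C0; rewrite !mxE eqxx /= mulr_natr.
have Cur : ursubmx C = 0.
  by apply/matrixP => i j; rewrite !mxE ord1 lshift0 C0j.
have Cdl : dlsubmx C = 0 by rewrite -Cs -trmx_ursub Cur trmx0.
have Cul : ulsubmx C = a%:M.
  by rewrite [LHS]mx11_scalar !mxE lshift0 C0j.
have [d [W [WW CdrE]]] : exists d (W : 'M_n),
    W *m W^T = 1%:M /\ drsubmx C = W^T *m diag_mx d *m W.
  by apply: IHn; rewrite trmx_drsub Cs.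
pose B : 'M_(1 + n) := block_mx 1%:M 0 0 W.
have BT : B^T = block_mx 1%:M 0 0 W^T by rewrite tr_block_mx trmx1 !trmx0.
have BB : B *m B^T = 1%:M.
  rewrite BT /B mulmx_block.
  rewrite !(mul0mx, mulmx0, mul1mx, mulmx1, addr0, add0r) WW.
  by rewrite -scalar_mx_block.
pose D : 'rV_(1 + n) := row_mx (a%:M : 'M_1) d.
have CE : C = B^T *m diag_mx D *m B.
  rewrite -[LHS]submxK Cul Cur Cdl CdrE BT /B /D diag_mx_row.
  have -> : diag_mx (a%:M : 'M_1) = a%:M by rewrite [LHS]mx11_scalar !mxE !eqxx.
  rewrite !mulmx_block.
  by rewrite !(mul0mx, mulmx0, mul1mx, mulmx1, addr0, add0r).
exists D, (B *m Q); split.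
  by rewrite trmx_mul mulmxA -(mulmxA B) QQ mulmx1 BB.
by rewrite AE CE trmx_mul !mulmxA.
Qed.

Definition adjacency_mx (H : sgraph) : 'M[R]_#|H| :=
  \matrix_(i, j) (adj (enum_val i) (enum_val j))%:R.

Lemma adjacency_mx_sym H : (adjacency_mx H)^T = adjacency_mx H.
Proof. by apply/matrixP => i j; rewrite !mxE adj_sym. Qed.

Definition adjacency_spectral (H : sgraph) : 'rV[R]_#|H| * 'M[R]_#|H| :=
  xchoose (symmetric_spectral (adjacency_mx_sym H)).

Lemma adjacency_spectralP H :
  spectral_decomp (adjacency_mx H) (adjacency_spectral H).
Proof. exact: xchooseP. Qed.

Definition vertex_energy (H : sgraph) (w : H) : R :=
  let: (lambda, U) := adjacency_spectral H in
  \sum_i `|lambda 0 i| * U (enum_rank w) i ^+ 2.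

(* The value does not depend on the decomposition chosen above. *)
Lemma vertex_energyE (H : sgraph) (w : H) (lambda : 'rV[R]_#|H|)
    (U : 'M[R]_#|H|) :
  spectral_decomp (adjacency_mx H) (lambda, U) ->
  vertex_energy w = \sum_i `|lambda 0 i| * U (enum_rank w) i ^+ 2.
Proof.
rewrite /vertex_energy; have := adjacency_spectralP H.
case: (adjacency_spectral H) => [mu V].
case/spectral_decompP=> VV VE /spectral_decompP[UU UE].
pose abs_mx (d : 'rV[R]_#|H|) := diag_mx (map_mx Num.norm d).
have energyE (d : 'rV_#|H|) (P : 'M_#|H|) : \sum_i `|d 0 i| * P (enum_rank w) i ^+ 2 =
    (P *m abs_mx d *m P^T) (enum_rank w) (enum_rank w).
  rewrite /abs_mx mul_mx_diag mxE; apply: eq_bigr => i _; rewrite !mxE.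
  by rewrite expr2 mulrA [`|_| * _]mulrC.
rewrite !{}energyE; congr fun_of_matrix.
have VV' : V *m V^T = 1%:M by apply: mulmx1C.
have UU' : U *m U^T = 1%:M by apply: mulmx1C.
pose W := V^T *m U.
have muW : diag_mx mu *m W = W *m diag_mx lambda.
  have : V^T *m adjacency_mx H *m U = V^T *m adjacency_mx H *m U by [].
  rewrite {1}VE UE /W !mulmxA VV mul1mx => ->.
  by rewrite -!mulmxA UU mulmx1.
have UVW : U = V *m W by rewrite /W mulmxA VV' mul1mx.
have WW : W *m W^T = 1%:M.
  by rewrite /W trmx_mul trmxK mulmxA -(mulmxA _ U) UU' mulmx1 VV.
move: W muW UVW WW => W muW UVW WW.
have absW : abs_mx mu *m W = W *m abs_mx lambda.
  apply/matrixP => i j; have /matrixP/(_ i j) := muW.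
  rewrite /abs_mx !mul_diag_mx !mul_mx_diag !mxE.
  have [-> _|W0] := eqVneq (W i j) 0; first by rewrite mulr0 mul0r.
  by rewrite [RHS]mulrC => /(mulIf W0) ->; rewrite mulrC.
by rewrite UVW trmx_mul -(mulmxA V W) -absW !mulmxA -(mulmxA _ W) WW mulmx1.
Qed.

End Spectral.

Arguments vertex_energy R H w : clear implicits.

(* Main.v *)
Require Import Defs.
From mathcomp Require Import all_boot all_order all_algebra.

Local Open Scope ring_scope.

(** Let [A] be the adjacency matrix of [G] and [J] the all-ones matrix of
    order [m].  Since adjacency of [(r, u)] and [(s, v)] in the shadow graph
    ignores [r] and [s], the adjacency matrix of the shadow graph is the
    Kronecker product of [J] and [A].  If [J = V diag(d) V^T] and
    [A = U diag(mu) U^T] with [V] and [U] orthogonal, the products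
    [V r s * U k i] are thus the entries of an orthonormal eigenbasis of the
    shadow graph, with eigenvalues [d s * mu i] ([shadow_spectral_decomp]).

    For this basis the vertex energy of [(r, k)] is a sum over pairs [(s, i)]
    which factors as [\sum_s |d s| (V r s)^2] times the vertex energy of [k].
    The first factor is the diagonal entry of the absolute value of [J]; as [J]
    is positive semidefinite, it is its own absolute value, and all its entries
    are 1 ([all_ones_diag_abs]). *)

Set Implicit Arguments.
Unset Strict Implicit.
Unset Printing Implicit Defensive.

Import Order.TTheory GRing.Theory Num.Theory.

Section Entries.
Variables (R : rcfType) (n : nat) (A U : 'M[R]_n) (d : 'rV[R]_n).
Hypothesis AdU : spectral_decomp A (d, U).

Lemma spectral_decomp_orthonormal i j :
  \sum_k U k i * U k j = (i == j)%:R.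
Proof.
have [UU _] := spectral_decompP _ _ _ AdU.
have /matrixP/(_ i j) := UU; rewrite !mxE => <-.
by apply: eq_bigr => k _; rewrite mxE.
Qed.

Lemma spectral_decomp_entry i j : A i j = \sum_k U i k * d 0 k * U j k.
Proof.
have [_ ->] := spectral_decompP _ _ _ AdU.
by rewrite mul_mx_diag mxE; apply: eq_bigr => k _; rewrite !mxE.
Qed.

Lemma spectral_decomp_eigenvalue k :
  d 0 k = \sum_i \sum_j U i k * A i j * U j k.
Proof.
have [UU AE] := spectral_decompP _ _ _ AdU.
have : (U^T *m A *m U) k k = d 0 k.
  by rewrite AE !mulmxA UU mul1mx -mulmxA UU mulmx1 mxE eqxx.
move=> <-; rewrite mxE exchange_big; apply: eq_bigr => j _ /=.
by rewrite mxE mulr_suml; apply: eq_bigr => i _; rewrite mxE.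
Qed.

End Entries.

(** Each eigenvalue of the all-ones matrix is nonnegative, because the quadratic
    form at the eigenvector [v] is the square of the sum of the entries of [v].
    So the absolute values can be dropped, and the sum is a diagonal entry of
    the all-ones matrix. *)
Lemma all_ones_diag_abs (R : rcfType) m (d : 'rV[R]_m) (V : 'M[R]_m) r :
  spectral_decomp (const_mx 1) (d, V) ->
  \sum_s `|d 0 s| * V r s ^+ 2 = 1.
Proof.
move=> JdV; have d_ge0 s : 0 <= d 0 s.
  rewrite (spectral_decomp_eigenvalue JdV).
  suff -> : \sum_i \sum_j V i s * const_mx 1 i j * V j s = (\sum_i V i s) ^+ 2.
    exact: sqr_ge0.
  rewrite expr2 mulr_suml; apply: eq_bigr => i _; rewrite mulr_sumr.
  by apply: eq_bigr => j _; rewrite mxE mulr1.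
have := spectral_decomp_entry JdV r r; rewrite mxE => ->.
apply: eq_bigr => s _; rewrite ger0_norm //.
by rewrite expr2 mulrA [d 0 s * _]mulrC.
Qed.

Section ShadowSpectrum.
Variables (R : rcfType) (m : nat) (G : sgraph).

(** Matrices of a graph are indexed by ordinals through the enumeration of its
    vertices, and that of the shadow graph need not list the copies of [G] one
    after the other; this map recovers the Kronecker indexing. *)
Definition shadow_index (p : 'I_#|shadow m G|) : 'I_m * 'I_#|G| :=
  ((enum_val p).1, enum_rank (enum_val p).2).

Lemma shadow_index_bij : bijective shadow_index.
Proof.
exists (fun x => enum_rank ((x.1, enum_val x.2) : shadow m G)) => [p|[s i]].
  by rewrite /shadow_index /= enum_rankK -surjective_pairing enum_valK.
by rewrite /shadow_index enum_rankK /= enum_valK.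
Qed.

Lemma sum_shadow_index (F : 'I_m -> 'I_#|G| -> R) :
  \sum_p F (shadow_index p).1 (shadow_index p).2 = \sum_s \sum_i F s i.
Proof.
rewrite pair_bigA [RHS](reindex shadow_index) //.
exact: onW_bij shadow_index_bij.
Qed.

Lemma adjacency_mx_shadow p q :
  adjacency_mx R (shadow m G) p q =
  adjacency_mx R G (shadow_index p).2 (shadow_index q).2.
Proof. by rewrite !mxE !enum_rankK; congr (_%:R); rewrite -shadow_adjE. Qed.

Variables (d : 'rV[R]_m) (V : 'M[R]_m).
Variables (mu : 'rV[R]_#|G|) (U : 'M[R]_#|G|).

(** The Kronecker products of [d] with [mu] and of [V] with [U]. *)
Definition shadow_eigenvalues : 'rV[R]_#|shadow m G| :=
  \row_p (d 0 (shadow_index p).1 * mu 0 (shadow_index p).2).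

Definition shadow_eigenvectors : 'M[R]_#|shadow m G| :=
  \matrix_(p, q) (V (shadow_index p).1 (shadow_index q).1 *
                  U (shadow_index p).2 (shadow_index q).2).

(** Both conditions are sums over pairs [(s, i)] of a product of a term in [s]
    by a term in [i].  Each factors into the same condition for [(d, V)] times
    the one for [(mu, U)]. *)
Lemma shadow_spectral_decomp :
  spectral_decomp (const_mx 1) (d, V) ->
  spectral_decomp (adjacency_mx R G) (mu, U) ->
  spectral_decomp (adjacency_mx R (shadow m G))
                  (shadow_eigenvalues, shadow_eigenvectors).
Proof.
move=> JdV AmuU; apply/spectral_decompP; split.
  apply/matrixP => p q; rewrite !mxE.
  pose F s i := (V s (shadow_index p).1 * V s (shadow_index q).1) *
                (U i (shadow_index p).2 * U i (shadow_index q).2).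
  rewrite (eq_bigr (fun x => F (shadow_index x).1 (shadow_index x).2)); last first.
    by move=> x _; rewrite !mxE mulrACA.
  rewrite sum_shadow_index -big_distrlr /=.
  rewrite (spectral_decomp_orthonormal JdV).
  rewrite (spectral_decomp_orthonormal AmuU).
  by rewrite -natrM mulnb -(bij_eq shadow_index_bij) -pair_eqE.
apply/matrixP => p q; rewrite adjacency_mx_shadow mul_mx_diag [RHS]mxE.
pose F s i :=
  (V (shadow_index p).1 s * d 0 s * V (shadow_index q).1 s) *
  (U (shadow_index p).2 i * mu 0 i * U (shadow_index q).2 i).
rewrite [RHS](eq_bigr (fun x => F (shadow_index x).1 (shadow_index x).2)).
  rewrite sum_shadow_index -big_distrlr /=.
  rewrite -(spectral_decomp_entry JdV).
  by rewrite -(spectral_decomp_entry AmuU) [const_mx _ _ _]mxE mul1r.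
by move=> x _; rewrite !mxE /F [RHS]mulrACA; congr (_ * _); rewrite mulrACA.
Qed.

End ShadowSpectrum.

Theorem theorem2 (R : rcfType) (m : nat) (hm : (1 <= m)%N) (G : sgraph)
  (r : 'I_m) (k : G) :
  vertex_energy R (shadow m G) (r, k) = vertex_energy R G k.
Proof.
have [|[d V] JdV] := @symmetric_spectral R m (const_mx 1).
  exact: trmx_const.
have [[mu U] AmuU] := symmetric_spectral (adjacency_mx_sym R G).
rewrite (vertex_energyE _ (shadow_spectral_decomp JdV AmuU)).
rewrite (vertex_energyE _ AmuU).
pose F s i := (`|d 0 s| * V r s ^+ 2) * (`|mu 0 i| * U (enum_rank k) i ^+ 2).
rewrite [LHS](eq_bigr (fun p => F (shadow_index p).1 (shadow_index p).2)).
  rewrite sum_shadow_index -big_distrlr /=.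
  by rewrite (all_ones_diag_abs r JdV) mul1r.
by move=> p _; rewrite !mxE /shadow_index enum_rankK normrM exprMn mulrACA.
Qed.
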